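(* Let $k,n$ be non-negative integers and let $p_1,\dots,p_{k+1}$ be primes (not necessarily distinct) with each $p_i\equiv 3\pmod 4$. Then for every integer $j$ not divisible by $p_{k+1}$, $$\mathcal{J}_{10}\Big(p_1^2p_2^2\cdots p_k^2\,p_{k+1}\,\big(4p_{k+1}n+4j+p_{k+1}\big)\Big)\equiv 0\pmod 2.$$
   Context: Let $q=e^{2\pi i\tau}$, $(a;q)_\infty=\prod_{j\ge0}(1-aq^j)$, and $\eta(\tau)=q^{1/24}(q;q)_\infty$. Define $$j_{10}(\tau)=\frac{\eta(2\tau)\eta(5\tau)^5}{\eta(\tau)\eta(10\tau)^5}-1=\frac1q+\sum_{n\ge0}\mathcal{J}_{10}(n)q^n.$$ *)

(* Defs.v *)
From HB Require Import structures.
From mathcomp Require Import all_boot all_order all_algebra.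
Set Implicit Arguments. Unset Strict Implicit. Unset Printing Implicit Defensive.
Import Order.TTheory GRing.Theory Num.Theory.
Local Open Scope ring_scope.

Definition geom (d N : nat) : {poly int} := \sum_(a < N.+1) 'X^(d * a).

(* Truncation of the q-product
     prod_{i>=1} (1-q^{2i}) (1-q^{5i})^5 / ((1-q^i) (1-q^{10i})^5)
   = (q^2;q^2)_oo (q^5;q^5)_oo^5 / ((q;q)_oo (q^10;q^10)_oo^5),
   correct modulo q^(N+1). *)
Definition eta_prod_trunc (N : nat) : {poly int} :=
  \prod_(1 <= i < N.+1)
     ((1 - 'X^(2 * i)) * (1 - 'X^(5 * i)) ^+ 5 * geom i N * (geom (10 * i) N) ^+ 5).

Definition eta_coef (m : nat) : int := (eta_prod_trunc m)`_m.

(* j10 = q^{-1} * (product above) - 1 = 1/q + sum_{n>=0} J10(n) q^n.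
   J10 z is the coefficient of q^z in the Laurent series j10, for every integer z
   (so J10 (-1) = 1 and J10 z = 0 for z < -1). *)
Definition J10 (z : int) : int :=
  match z with
  | Posz n => eta_coef n.+1 - (n == 0%N)%:R
  | Negz 0 => eta_coef 0
  | Negz _ => 0
  end.

(* Main.v *)
(* Let a = (q; q)_oo and b = (q^5; q^5)_oo over F_2.  Since squaring is
   substituting q^2 for q, the eta quotient of j10 is P = a / b^5.  The Jacobi
   triple product gives a^3 = sum_x q^(2 x^2 + x) and
   a b = sum_(m, n) q^((5 m^2 + 3 m + 5 n^2 + n) / 2), sums over the integers.
   The second exponent E satisfies 4 E + 1 = s^2 + t^2 with s = 3 m + n + 1 and
   t = m - 3 n; up to units, these are the Gaussian integers of norm 4 E + 1
   that are not multiples of 1 + 2i.  Hence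
     a b = sum_(x, y) q^(4 x^2 + 2 x + y^2) - q sum_(x, y) q^(5 (4 x^2 + 2 x + y^2)),
   and sum_y q^(y^2) = 1 mod 2, so a b = a^6 + q b^6.
   With u = a / b this reads P = q + u^6, and also u^3 = (u^4 b^2)^2 + q (a b)^2.
   Comparing coefficients, J10(4 l + 1) is congruent mod 2 to the coefficient of
   q^l in a b = a^6 + q b^6, so it is even unless 4 l + 1 is a square or five
   times a square; p_(k+1) occurs to an odd power in the argument of J10. *)
Require Import Defs.
From HB Require Import structures.
From mathcomp Require Import all_boot all_order all_algebra.
From mathcomp Require Import zify ring.
Set Implicit Arguments.
Unset Strict Implicit.
Unset Printing Implicit Defensive.
Import Order.TTheory GRing.Theory Num.Theory.
Local Open Scope ring_scope.

(** * Gaussian binomial coefficients and the finite q-binomial theorem *)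

Fixpoint qbin (R : comNzRingType) (Q : R) (N k : nat) : R :=
  match N, k with
  | _, 0%N => 1
  | 0%N, _.+1 => 0
  | N'.+1, k'.+1 => qbin Q N' k' + Q ^+ k * qbin Q N' k
  end.

Lemma qbin0 (R : comNzRingType) (Q : R) N : qbin Q N 0 = 1.
Proof. by case: N. Qed.

Lemma qbin_small (R : comNzRingType) (Q : R) N k : (N < k)%N -> qbin Q N k = 0.
Proof.
elim: N k => [|N IHN] [|k] //= ltNk.
by rewrite !IHN ?mulr0 ?addr0 //; lia.
Qed.

(** Splitting off the factor [i = 0] leaves the same product with [x * Q] for [x]. The homogeneous
    form matters: a monomial [y] will later stand in for negative powers of the variable. *)
Lemma qbin_theorem (R : comNzRingType) (Q x y : R) N :
  \prod_(i < N) (y + x * Q ^+ i) =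
  \sum_(k < N.+1) Q ^+ 'C(k, 2) * qbin Q N k * x ^+ k * y ^+ (N - k).
Proof.
elim: N x => [|N IHN] x.
  by rewrite big_ord0 big_ord_recl big_ord0 /= !(expr0, mulr1, addr0).
rewrite big_ord_recl /= expr0 mulr1.
under eq_bigr => i _ do rewrite /bump /= add1n exprS mulrA.
rewrite IHN mulrDl !mulr_sumr big_ord_recl [in RHS]big_ord_recl /= -addrA.
congr (_ + _); first by rewrite !qbin0 bin0n !subn0 !expr0 !mul1r exprS.
under [in RHS]eq_bigr => k _ do
  rewrite /bump /= add1n subSS mulrDr mulrDl mulrDl.
rewrite [in RHS]big_split /= addrC; congr (_ + _).
  apply: eq_bigr => k _.
  by rewrite binS bin1 exprD exprMn exprS ?add0n; ring.
rewrite [in RHS]big_ord_recr /= qbin_small // !(mulr0, mul0r) addr0.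
apply: eq_bigr => k _; rewrite /bump /= add1n.
by rewrite -(subnSK (ltn_ord k)) exprMn !exprS; ring.
Qed.

Definition qpoch (R : nzRingType) (Q : R) n : R := \prod_(i < n) (1 - Q ^+ i.+1).

Lemma qpochS (R : nzRingType) (Q : R) n :
  qpoch Q n.+1 = qpoch Q n * (1 - Q ^+ n.+1).
Proof. by rewrite /qpoch big_ord_recr. Qed.

Lemma qbin_diag (R : comNzRingType) (Q : R) N : qbin Q N N = 1.
Proof. by elim: N => //= N ->; rewrite qbin_small // mulr0 addr0. Qed.

Lemma qbin_qpoch (R : comNzRingType) (Q : R) a b :
  qbin Q (a + b) a * qpoch Q a * qpoch Q b = qpoch Q (a + b).
Proof.
have [n] := ubnP (a + b); elim: n a b => // n IHn [|a] [|b] ltn.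
- by rewrite /= /qpoch big_ord0 !mulr1.
- by rewrite qbin0 add0n /qpoch big_ord0 !mul1r.
- by rewrite addn0 qbin_diag mul1r {2}/qpoch big_ord0 mulr1.
have IH1 : _ = qpoch Q (a + b.+1) := IHn a b.+1 ltac:(lia).
have IH2 : _ = qpoch Q (a.+1 + b) := IHn a.+1 b ltac:(lia).
rewrite addSnnS in IH2; rewrite addSn [RHS]qpochS /=.
(* With A = a+1 and B = b+1, 1 - Q^(A+B) = (1 - Q^A) + Q^A (1 - Q^B), matching the two terms of
   Pascal's recurrence. *)
rewrite [RHS](_ : _ = (1 - Q ^+ a.+1) * qpoch Q (a + b.+1) +
    Q ^+ a.+1 * (1 - Q ^+ b.+1) * qpoch Q (a + b.+1)); last first.
  by rewrite -addSn exprD; ring.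
by rewrite -{1}IH1 -IH2 !qpochS; ring.
Qed.

(** * The finite Jacobi triple product *)

(* The exponent of q in the m-th term of Ramanujan's theta function
   f(q^al, q^be). *)
Definition texp (al be : nat) (m : int) : nat :=
  `|((al%:Z * (m * (m + 1)) + be%:Z * (m * (m - 1))) %/ 2)%Z|%N.

Lemma texpE al be m :
  2 * (texp al be m)%:Z = al%:Z * (m * (m + 1)) + be%:Z * (m * (m - 1)).
Proof.
have [h Eh] : exists h : int, m * (m + 1) = 2 * h.
  have [d [] ->] : exists d : int, m = 2 * d \/ m = 2 * d + 1.
  - by exists (m %/ 2)%Z; lia.
  - by exists (d * (2 * d + 1)); ring.
  - by exists ((2 * d + 1) * (d + 1)); ring.
have Eh' : m * (m - 1) = 2 * (h - m) by nia.
have h0 : 0 <= h by nia.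
have h1 : 0 <= h - m by nia.
rewrite /texp Eh Eh'.
have -> : al%:Z * (2 * h) + be%:Z * (2 * (h - m)) = (al%:Z * h + be%:Z * (h - m)) * 2.
  by ring.
by rewrite mulzK // gez0_abs; [ring | nia].
Qed.

Lemma texp_lb al be m : (0 < al)%N -> (0 < be)%N -> (`|m| <= texp al be m)%N.
Proof.
move=> al0 be0; have := texpE al be m.
have : 0 <= m * (m + 1) by nia.
have : 0 <= m * (m - 1) by nia.
have : `|m| <= m * m by nia.
nia.
Qed.

Lemma prod_Xn (R : comNzRingType) (a D M n : nat) :
  \prod_(i < n) ('X^(a + D * i) * 'X^M) = 'X^(a * n + D * 'C(n, 2) + M * n) :> {poly R}.
Proof.
elim: n => [|n IHn]; first by rewrite big_ord0 !muln0.
rewrite big_ord_recr /= IHn -!exprD; congr 'X^_.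
by rewrite binS bin1; lia.
Qed.

Lemma finite_jtp (F : fieldType) (al be n : nat) :
  \prod_(i < n) ((1 + 'X^(al + (al + be) * i)) * (1 + 'X^(be + (al + be) * i))) =
  \sum_(k < (n + n).+1) qbin 'X^(al + be) (n + n) k *
     'X^(texp al be (k%:Z - n%:Z)) :> {poly F}.
Proof.
set D := (al + be)%N.
(* The product of the monomials extracted from the factors X^(Dn) + X^(al + Di), i < 2n: X^(al + Di)
   for i < n and X^(Dn) for i >= n. What remains is the left-hand product, the factors with i < n
   taken in reverse order. *)
apply: (@mulfI _ 'X^(al * n + D * 'C(n, 2) + D * n * n)).
  by rewrite -size_poly_eq0 size_polyXn.
transitivity (\prod_(i < n + n) ('X^(D * n) + 'X^al * 'X^D ^+ i) : {poly F}).
  rewrite big_split_ord /= -prod_Xn [X in X * _ = _](reindex_inj rev_ord_inj).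
  rewrite [X in _ = X * _](reindex_inj rev_ord_inj).
  rewrite -!big_split /=; apply: eq_bigr => i _.
  have ltin := ltn_ord i.
  rewrite -!exprM -!exprD.
  have E : (D * n = al + D * (n - i.+1) + (be + D * i))%N by rewrite /D; nia.
  have -> : (al + D * (n + i) = al + D * i + D * n)%N by lia.
  by rewrite !E !exprD; ring.
rewrite qbin_theorem mulr_sumr; apply: eq_bigr => k _.
have lekn : (k <= n + n)%N by rewrite -ltnS.
have E : (D * 'C(k, 2) + al * k + D * n * (n + n - k) =
  al * n + D * 'C(n, 2) + D * n * n + texp al be (k%:Z - n%:Z))%N.
  have bin2E m : 2 * ('C(m, 2))%:Z = m%:Z * (m%:Z - 1).
    by elim: m => // m IHm; rewrite binS bin1; lia.
  have := bin2E n; have := bin2E k; have := texpE al be (k%:Z - n%:Z).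
  rewrite /D; nia.
rewrite -!exprM [RHS]mulrCA -exprD -E !exprD; ring.
Qed.

(** * Power series as polynomials modulo X^N, and the limit of the triple product *)

Definition eqmX (F : fieldType) (N : nat) (p r : {poly F}) := 'X^N %| p - r.

Definition theta (F : fieldType) (n : nat) (e : int -> nat) : {poly F} :=
  \sum_(k < (n + n).+1) 'X^(e (k%:Z - n%:Z)).
Arguments theta {F}.

Section Congruence.
Variables (F : fieldType) (N : nat).
Implicit Types p r s t : {poly F}.

Lemma eqmX_refl p : eqmX N p p.
Proof. by rewrite /eqmX subrr dvdp0. Qed.

Lemma eqmX_sym p r : eqmX N p r -> eqmX N r p.
Proof. by rewrite /eqmX -opprB dvdpNr. Qed.

Lemma eqmX_trans r p s : eqmX N p r -> eqmX N r s -> eqmX N p s.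
Proof. by rewrite /eqmX => pr rs; rewrite -(subrKA r) dvdp_add. Qed.

Lemma eqmXD p r s t : eqmX N p r -> eqmX N s t -> eqmX N (p + s) (r + t).
Proof. by rewrite /eqmX => pr st; rewrite opprD addrACA dvdp_add. Qed.

Lemma eqmXM p r s t : eqmX N p r -> eqmX N s t -> eqmX N (p * s) (r * t).
Proof.
rewrite /eqmX => pr st.
rewrite (_ : p * s - r * t = (p - r) * s + r * (s - t)); last by ring.
by apply: dvdp_add; [apply: dvdp_mulr | apply: dvdp_mull].
Qed.

Lemma eqmX_exp p r k : eqmX N p r -> eqmX N (p ^+ k) (r ^+ k).
Proof.
move=> pr; elim: k => [|k IHk]; first exact: eqmX_refl.
by rewrite !exprS; apply: eqmXM.
Qed.

Lemma eqmX_sum n (G H : 'I_n -> {poly F}) :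
  (forall i, eqmX N (G i) (H i)) -> eqmX N (\sum_i G i) (\sum_i H i).
Proof.
by move=> GH; apply: (big_ind2 (@eqmX F N)) => //; [exact: eqmX_refl | exact: eqmXD].
Qed.

Lemma eqmX_prod n (G H : 'I_n -> {poly F}) :
  (forall i, eqmX N (G i) (H i)) -> eqmX N (\prod_i G i) (\prod_i H i).
Proof.
by move=> GH; apply: (big_ind2 (@eqmX F N)) => //; [exact: eqmX_refl | exact: eqmXM].
Qed.

Lemma eqmX_cancel s p r : s.[0] = 1 -> eqmX N (s * p) (s * r) -> eqmX N p r.
Proof.
move=> s0; rewrite /eqmX -mulrBr Gauss_dvdpr //.
by rewrite coprimep_expl // coprimep_sym coprimepX rootE s0 oner_eq0.
Qed.

Lemma eqmX_le M p r : (N <= M)%N -> eqmX M p r -> eqmX N p r.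
Proof. by move=> leNM; apply: dvdp_trans; rewrite dvdp_exp2l. Qed.

Lemma eqmX_coef p r i : eqmX N p r -> (i < N)%N -> p`_i = r`_i.
Proof.
move=> /dvdpP[s Es] ltiN; apply/eqP; rewrite -subr_eq0 -coefB Es.
by rewrite coefMXn ltiN.
Qed.

Lemma coef_eqmX p r : (forall i, (i < N)%N -> p`_i = r`_i) -> eqmX N p r.
Proof.
move=> Epr; rewrite /eqmX -[p - r](poly_take_drop N) dvdp_add ?dvdp_mull //.
rewrite (_ : take_poly N _ = 0) ?dvdp0 //; apply/polyP => i.
by rewrite coef_take_poly coefB coef0; case: ifP => // /Epr->; rewrite subrr.
Qed.
End Congruence.

Lemma qpoch_at0 (F : fieldType) D n :
  (0 < D)%N -> (qpoch ('X^D : {poly F}) n).[0] = 1.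
Proof.
move=> D0; rewrite horner_prod big1 // => i _.
by rewrite -exprM !hornerE expr0n muln_eq0 /= eqn0Ngt D0 subr0.
Qed.

Lemma qpoch_stable (F : fieldType) D n t : (t <= n)%N ->
  eqmX (D * t.+1) (qpoch ('X^D : {poly F}) n) (qpoch ('X^D : {poly F}) t).
Proof.
move=> /subnK<-; elim: (n - t)%N => [|k IHk]; first exact: eqmX_refl.
apply: eqmX_trans IHk; rewrite addSn qpochS -exprM.
rewrite /eqmX mulrBr mulr1 addrAC subrr add0r dvdpNr dvdp_mull //.
by rewrite dvdp_exp2l // leq_mul2l; lia.
Qed.

(** In [qbin_qpoch], each of the q-factorials of [k], [2n - k], [n] and [2n] may be replaced by that
    of [t], since the further factors are 1 modulo X^(D(t+1)). *)
Lemma qbin_qpoch_cvg (F : fieldType) D n k : (0 < D)%N -> (k <= n + n)%N ->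
  eqmX (D * (minn k (n + n - k)).+1)
    (qbin 'X^D (n + n) k * qpoch ('X^D : {poly F}) n) 1.
Proof.
move=> D0 lek2n; set t := minn _ _.
pose f := qpoch ('X^D : {poly F}).
have ft j : (t <= j)%N -> eqmX (D * t.+1) (f j) (f t) by exact: qpoch_stable.
have ft0 : (f t).[0] = 1 by exact: qpoch_at0.
apply: (eqmX_cancel (s := f t)) => //.
apply: eqmX_trans (_ : eqmX _ (qbin 'X^D (n + n) k * f t * f t) _).
  rewrite mulrC; apply: eqmXM (eqmX_refl _ _).
  by apply: eqmXM (eqmX_refl _ _) _; apply: ft; rewrite /t; lia.
rewrite mulr1; apply: eqmX_trans (ft (n + n)%N _); last by rewrite /t; lia.
have := qbin_qpoch ('X^D : {poly F}) k (n + n - k); rewrite subnKC // /f => <-.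
apply: eqmX_sym.
apply: eqmXM; last by apply: ft; rewrite /t; lia.
by apply: eqmXM (eqmX_refl _ _) _; apply: ft; rewrite /t; lia.
Qed.

(** The k-th term of [finite_jtp] is accurate to order D(min(k, 2n-k) + 1), and its monomial adds at
    least |k - n|. As min(k, 2n-k) + |k - n| = n, the total is at least n + 1. *)
Lemma jtp (F : fieldType) (al be n : nat) : (0 < al)%N -> (0 < be)%N ->
  eqmX n.+1
   (\prod_(i < n) ((1 + 'X^(al + (al + be) * i)) * (1 + 'X^(be + (al + be) * i)))
     * qpoch ('X^(al + be) : {poly F}) n)
   (theta n (texp al be)).
Proof.
move=> al0 be0; rewrite finite_jtp mulr_suml; apply: eqmX_sum => k.
have lek2n : (k <= n + n)%N by rewrite -ltnS.
rewrite mulrAC.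
have := @qbin_qpoch_cvg F (al + be) n k ltac:(lia) lek2n.
rewrite /eqmX -{2}['X^(texp _ _ _)]mul1r -mulrBl => cvg.
have := dvdp_mul cvg (dvdpp 'X^(texp al be (k%:Z - n%:Z))).
rewrite -exprD; apply: dvdp_trans; rewrite dvdp_exp2l //.
have := texp_lb (k%:Z - n%:Z) al0 be0.
set t := minn _ _.
have : (t.+1 <= (al + be) * t.+1)%N by apply: leq_pmull; lia.
by rewrite /t; lia.
Qed.

(** * Euler products over F_2 as theta series *)

Lemma polyF2_2 : 2%:R = 0 :> {poly 'F_2}.
Proof. by rewrite -polyC_natr pchar_Fp_0. Qed.

Lemma polyF2_opp (p : {poly 'F_2}) : - p = p.
Proof.
by apply/eqP; rewrite -subr_eq0 -opprD oppr_eq0 -mulr2n -mulr_natl polyF2_2 mul0r.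
Qed.

Definition euler2 (r n : nat) : {poly 'F_2} := qpoch 'X^r n.

Lemma euler2E r n : euler2 r n = \prod_(i < n) (1 + 'X^(r * i.+1)).
Proof. by apply: eq_bigr => i _; rewrite -exprM polyF2_opp. Qed.

Lemma euler2_at0 r n : (0 < r)%N -> (euler2 r n).[0] = 1.
Proof. exact: qpoch_at0. Qed.

Lemma euler2_stable r n t : (0 < r)%N -> (t <= n)%N ->
  eqmX t.+1 (euler2 r n) (euler2 r t).
Proof.
by move=> r0 letn; apply: eqmX_le (qpoch_stable _ _ letn); exact: leq_pmull.
Qed.

Lemma euler2_double r n : euler2 (2 * r) n = euler2 r n ^+ 2.
Proof.
rewrite !euler2E -prodrXl; apply: eq_bigr => i _.
by rewrite -mulnA mulnC exprM; move: ('X^_) => y; ring: polyF2_2.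
Qed.

Lemma euler2_blocks r d n : euler2 r (d * n) =
  \prod_(i < n) \prod_(j < d) (1 + 'X^(r * (d * i + j.+1))).
Proof.
rewrite euler2E; elim: n => [|n IHn]; first by rewrite muln0 !big_ord0.
rewrite big_ord_recr /= -IHn mulnS addnC big_split_ord /=; congr (_ * _).
by apply: eq_bigr => j _; rewrite addnS.
Qed.

(** The triple product gives O f(q^2)^2 = O f^4, where O runs over the odd multiples of r. Splitting
    exponents by parity, f = O f(q^2) = O f^2, so O f = 1 and O f^4 = f^3. *)
Lemma euler2_cube r n : (0 < r)%N ->
  eqmX n.+1 (euler2 r n ^+ 3) (theta n (texp (3 * r) r)).
Proof.
move=> r0.
have := @jtp 'F_2 (3 * r) r n ltac:(lia) r0.
rewrite [(3 * r + r)%N](_ : _ = 2 * (2 * r))%N; last by lia.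
rewrite -/(euler2 _ _) !euler2_double -exprM.
set O := \prod_(i < n) _; set f := euler2 r n => thetaE.
have splitE : euler2 r (4 * n) = O * euler2 r (2 * n) ^+ 2.
  rewrite -euler2_double !euler2_blocks -big_split /=.
  apply: eq_bigr => i _; rewrite !big_ord_recl !big_ord0 /= !mulr1.
  rewrite -[bump 0 0]/1%N -[bump 0 1]/2%N -[bump 0 2]/3%N.
  have -> : (3 * r + 2 * (2 * r) * i = r * (4 * i + 3))%N by lia.
  have -> : (r + 2 * (2 * r) * i = r * (4 * i + 1))%N by lia.
  have -> : (2 * r * (2 * i + 1) = r * (4 * i + 2))%N by lia.
  have -> : (2 * r * (2 * i + 2) = r * (4 * i + 4))%N by lia.
  ring.
apply: eqmX_trans thetaE.
have f0 : f.[0] = 1 by exact: euler2_at0.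
have fE k : (0 < k)%N -> eqmX n.+1 (euler2 r (k * n)) f.
  by move=> k0; apply: euler2_stable => //; exact: leq_pmull.
have Of1 : eqmX n.+1 1 (O * f).
  apply: (eqmX_cancel f0); rewrite mulr1 mulrCA -expr2.
  apply: eqmX_trans (eqmX_sym (fE 4 isT)) _; rewrite splitE.
  by apply: eqmXM (eqmX_refl _ _) _; apply/eqmX_exp/fE.
have := eqmXM Of1 (eqmX_refl n.+1 (f ^+ 3)).
by rewrite mul1r -mulrA -exprS.
Qed.

(** The two triple products cover the residues 4, 1 and 3, 2 modulo 5. One of their two factors
    (q^5; q^5) supplies the residue 0 and completes (q; q); the other is left over. *)
Lemma euler2_mul15 n :
  eqmX n.+1 (euler2 1 n * euler2 5 n) (theta n (texp 4 1) * theta n (texp 3 2)).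
Proof.
have := eqmXM (@jtp 'F_2 4 1 n isT isT) (@jtp 'F_2 3 2 n isT isT).
apply: eqmX_trans.
set P1 := \prod_(i < n) _; set P2 := \prod_(i < n) _; set f5 := qpoch _ _.
have E : euler2 1 (5 * n) = P1 * P2 * f5.
  rewrite /f5 -/(euler2 5 n) euler2_blocks euler2E -!big_split /=.
  apply: eq_bigr => i _; rewrite !big_ord_recl big_ord0 /=.
  rewrite -[bump 0 0]/1%N -[bump 0 1]/2%N -[bump 0 2]/3%N -[bump 0 3]/4%N !mul1n.
  rewrite !(addnC (5 * i)%N) [(5 * i.+1)%N]mulnS; ring.
rewrite mulrACA mulrA -E.
by apply: eqmXM (eqmX_refl _ _); apply/eqmX_sym/euler2_stable => //; lia.
Qed.

(** * Counting Gaussian integers of given norm *)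

Definition irange (K : nat) : seq int := [seq k%:Z - K%:Z | k <- iota 0 (K + K + 1)].

Lemma mem_irange K x : (x \in irange K) = (`|x| <= K)%N.
Proof.
apply/mapP/idP => [[k] | lexK]; first by rewrite mem_iota => ? ->; lia.
by exists (absz (x + K%:Z)); [rewrite mem_iota; lia | lia].
Qed.

Lemma irange_uniq K : uniq (irange K).
Proof. by rewrite map_inj_uniq ?iota_uniq // => i j; lia. Qed.

Definition ibox (K : nat) : seq (int * int) :=
  [seq (x, y) | x <- irange K, y <- irange K].

Lemma mem_ibox K z : (z \in ibox K) = (`|z.1| <= K)%N && (`|z.2| <= K)%N.
Proof.
case: z => x y; rewrite -!mem_irange; apply/allpairsP/andP => /=.
  by case=> [[u v]] /= [uK vK [-> ->]].
by case=> xK yK; exists (x, y).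
Qed.

Lemma ibox_uniq K : uniq (ibox K).
Proof.
apply: allpairs_uniq; rewrite ?irange_uniq //.
by move=> [? ?] [? ?] _ _ [-> ->].
Qed.

Lemma thetaE (F : fieldType) K e :
  theta K e = \sum_(x <- irange K) 'X^(e x) :> {poly F}.
Proof.
by rewrite /theta big_map addn1 -[iota _ _]/(index_iota 0 (K + K).+1) big_mkord.
Qed.

Lemma coef_theta_mul (F : fieldType) K e1 e2 E :
  (theta K e1 * theta K e2 : {poly F})`_E =
  (count (fun z => e1 z.1 + e2 z.2 == E)%N (ibox K))%:R.
Proof.
rewrite !thetaE big_distrlr.
rewrite -(big_allpairs (F := fun z => 'X^(e1 z.1) * 'X^(e2 z.2))) -/(ibox K).
elim: (ibox K) => [|z s IHs]; first by rewrite big_nil coef0.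
by rewrite big_cons coefD IHs -exprD coefXn eq_sym -natrD.
Qed.

Lemma theta_even (K : nat) (e : int -> nat) :
  e 0 = 0%N -> (forall x, e (- x) = e x) -> theta K e = 1 :> {poly 'F_2}.
Proof.
move=> e0 eN; rewrite /theta -addnS big_split_ord /= big_ord_recl /=.
rewrite addn0 subrr e0 expr0 addrCA (reindex_inj rev_ord_inj) /=.
rewrite -big_split big1 ?addr0 //= => i _.
rewrite -eN (_ : - _ = (K + bump 0 i)%N%:Z - K%:Z); last first.
  by have := ltn_ord i; rewrite /bump /=; lia.
by rewrite -[in X in X + _](polyF2_opp 'X^_) addNr.
Qed.

(* [(3m + n + 1) + i (m - 3n)] is multiplied by the unit that makes it
   congruent to [1 mod 4] in its real part and even in its imaginary part. *)
Definition to_square (z : int * int) : int * int :=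
  let s := 3 * z.1 + z.2 + 1 in let t := z.1 - 3 * z.2 in
  if (s %% 4)%Z == 1 then (((s - 1) %/ 4)%Z, (t %/ 2)%Z)
  else if (s %% 4)%Z == 3 then (((- s - 1) %/ 4)%Z, (- t %/ 2)%Z)
  else if (t %% 4)%Z == 1 then (((t - 1) %/ 4)%Z, (- s %/ 2)%Z)
  else (((- t - 1) %/ 4)%Z, (s %/ 2)%Z).

(** For s = 3m + n + 1 and t = m - 3n one has s + 2t = 1 mod 5, which selects the unit; then 3s + t
    = 10m + 3 and s - 3t = 10n + 1 recover m and n. *)
Definition of_square (z : int * int) : int * int :=
  let s := 4 * z.1 + 1 in let t := 2 * z.2 in
  let st := if ((s + 2 * t) %% 5)%Z == 1 then (s, t)
            else if ((s + 2 * t) %% 5)%Z == 4 then (- s, - t)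
            else if ((s + 2 * t) %% 5)%Z == 3 then (- t, s) else (t, - s) in
  (((3 * st.1 + st.2 - 3) %/ 10)%Z, ((st.1 - 3 * st.2 - 1) %/ 10)%Z).

(* Multiplication of [(4x + 1) + i 2y] by [1 + 2i]. *)
Definition mul12i (z : int * int) : int * int := (z.1 - z.2, 4 * z.1 + 1 + z.2).

Lemma to_squareK : cancel to_square of_square.
Proof.
move=> [m n]; rewrite /to_square /=.
by do 3?[case: ifPn => ?]; rewrite /of_square /=; do 3?[case: ifPn => ?];
  congr pair => /=; lia.
Qed.

(** The hypothesis says that 5 does not divide s + 2t = 4(x + y) + 1, that is, (4x + 1) + 2iy is not
    a multiple of 1 + 2i. *)
Lemma of_squareK z : ((z.1 + z.2) %% 5)%Z != 1 -> to_square (of_square z) = z.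
Proof.
case: z => x y; rewrite /of_square /= => ?.
by do 3?[case: ifPn => ?]; rewrite /to_square /=; do 3?[case: ifPn => ?];
  congr pair => /=; lia.
Qed.

Lemma to_squareP z (s := 3 * z.1 + z.2 + 1) (t := z.1 - 3 * z.2) :
  (4 * (to_square z).1 + 1, 2 * (to_square z).2) \in
    [:: (s, t); (- s, - t); (t, - s); (- t, s)].
Proof.
rewrite /to_square -/s -/t !inE !xpair_eqE.
have tE : t = s - 1 - 2 * (z.1 + 2 * z.2) by rewrite /s /t; ring.
by clearbody s t; do 3?[case: ifPn => ? /=]; lia.
Qed.

Lemma to_square_class z :
  (((to_square z).1 + (to_square z).2) %% 5)%Z != 1.
Proof.
have /= := to_squareP z; rewrite !inE !xpair_eqE; move: (to_square z) => [x y] /=.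
by case/or4P => /andP[/eqP ? /eqP ?]; lia.
Qed.

Lemma to_square_norm z :
  (4 * (to_square z).1 + 1) ^+ 2 + (2 * (to_square z).2) ^+ 2 =
  (3 * z.1 + z.2 + 1) ^+ 2 + (z.1 - 3 * z.2) ^+ 2.
Proof.
have /= := to_squareP z; rewrite !inE !xpair_eqE.
by case/or4P => /andP[/eqP-> /eqP->]; rewrite ?sqrrN // addrC.
Qed.

(** The right-hand side counts the (4x + 1) + 2iy of norm 4E + 1. Those prime to 1 + 2i are the
    image of [to_square], the others the image of [mul12i]. The bound on [E] keeps every solution
    inside the box. *)
Lemma theta_count K E : (E <= K)%N ->
  (count (fun z => texp 4 1 z.1 + texp 3 2 z.2 == E) (ibox K) +
  count (fun z => (texp 30 10 z.1 + texp 5 5 z.2).+1 == E) (ibox K) =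
  count (fun z => texp 6 2 z.1 + texp 1 1 z.2 == E) (ibox K))%N.
Proof.
move=> leEK.
set P1 := fun z => _; set P3 := fun z => _; set P2 := fun z => _.
have P1E z : P1 z = (5 * z.1 ^+ 2 + 3 * z.1 + 5 * z.2 ^+ 2 + z.2 == 2 * E%:Z).
  by have := texpE 4 1 z.1; have := texpE 3 2 z.2; rewrite /P1 !expr2; lia.
have P2E z : P2 z = (4 * z.1 ^+ 2 + 2 * z.1 + z.2 ^+ 2 == E%:Z).
  by have := texpE 6 2 z.1; have := texpE 1 1 z.2; rewrite /P2 !expr2; lia.
have P3E z : P3 z = (5 * (4 * z.1 ^+ 2 + 2 * z.1 + z.2 ^+ 2) + 1 == E%:Z).
  by have := texpE 30 10 z.1; have := texpE 5 5 z.2; rewrite /P3 !expr2; lia.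
have box1 z : P1 z -> z \in ibox K.
  rewrite mem_ibox => /eqP /= EP.
  by have := @texp_lb 4 1 z.1 isT isT; have := @texp_lb 3 2 z.2 isT isT; lia.
have box2 z : P2 z -> z \in ibox K.
  rewrite mem_ibox => /eqP /= EP.
  by have := @texp_lb 6 2 z.1 isT isT; have := @texp_lb 1 1 z.2 isT isT; lia.
have box3 z : P3 z -> z \in ibox K.
  rewrite mem_ibox => /eqP /= EP.
  by have := @texp_lb 30 10 z.1 isT isT; have := @texp_lb 5 5 z.2 isT isT; lia.
have P12 z : P1 z = P2 (to_square z).
  by rewrite P1E P2E; have := to_square_norm z; rewrite !expr2; lia.
have P32 z : P3 z = P2 (mul12i z).
  by rewrite P3E P2E /mul12i /= !expr2; lia.
(* Explicit division of (4x + 1) + 2iy by 1 + 2i. *)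
have mul12iK x y : ((x + y) %% 5)%Z = 1 ->
    mul12i (((x + y - 1) %/ 5)%Z, ((x + y - 1) %/ 5)%Z - x) = (x, y).
  by move=> ?; congr pair => /=; lia.
have mul12i_inj : injective mul12i.
  by move=> [x y] [u v] [] /= *; congr pair; lia.
rewrite -!size_filter -(size_map to_square) -(size_map mul12i (filter P3 _)).
rewrite -size_cat; apply: perm_size; apply: uniq_perm.
- rewrite cat_uniq !map_inj_uniq ?filter_uniq ?ibox_uniq //=; last first.
    exact: can_inj to_squareK.
  rewrite andbT; apply/hasPn => _ /mapP[z _ ->]; apply/mapP => -[w _ Ew].
  by have := to_square_class w; rewrite -Ew /mul12i /=; lia.
- by rewrite filter_uniq ?ibox_uniq.
move=> z; rewrite mem_cat mem_filter.
apply/orP/andP => [[] /mapP[w]|[P2z _]].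
- by rewrite mem_filter P12 => /andP[? _] ->; split=> //; apply: box2.
- by rewrite mem_filter P32 => /andP[? _] ->; split=> //; apply: box2.
have [z1 | z1] := eqVneq ((z.1 + z.2) %% 5)%Z 1; last first.
  left; apply/mapP; exists (of_square z); last by rewrite of_squareK.
  have P1z : P1 (of_square z) by rewrite P12 of_squareK.
  by rewrite mem_filter P1z box1.
right; case: z z1 P2z => x y z1 P2z; rewrite -(mul12iK _ _ z1).
by apply: map_f; rewrite mem_filter P32 mul12iK // P2z box3 // P32 mul12iK.
Qed.

Lemma theta_sqr K a : theta K (texp a a) = 1 :> {poly 'F_2}.
Proof.
apply: theta_even => [|x]; first by rewrite /texp !mul0r !mulr0.
by rewrite /texp; congr (absz (_ %/ 2)%Z); ring.
Qed.

Lemma euler2_sixth r n : (0 < r)%N ->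
  eqmX n.+1 (euler2 r n ^+ 6) (theta n (texp (6 * r) (2 * r))).
Proof.
move=> r0; rewrite (exprM _ 2 3) -euler2_double (_ : 6 * r = 3 * (2 * r))%N; last by lia.
by apply: euler2_cube; lia.
Qed.

Lemma euler2_level5 n :
  eqmX n.+1 (euler2 1 n * euler2 5 n) (euler2 1 n ^+ 6 + 'X * euler2 5 n ^+ 6).
Proof.
apply: eqmX_trans (euler2_mul15 n) _; apply: eqmX_sym.
apply: eqmX_trans (eqmXD (euler2_sixth n (isT : 0 < 1)%N)
  (eqmXM (eqmX_refl _ 'X) (euler2_sixth n (isT : 0 < 5)%N))) _.
apply: coef_eqmX => E leEn.
(* Inserting the factor 1 = sum of X^(a y^2) turns each sixth power into a series in two
   variables. *)
rewrite -[theta n (texp (6 * 1) _)]mulr1 -(theta_sqr n 1).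
rewrite -[theta n (texp (6 * 5) _)]mulr1 -(theta_sqr n 5).
rewrite coefD coefXM !coef_theta_mul -(theta_count (leEn : E <= n)%N) natrD.
case: E leEn => [|E] _ /=.
  rewrite addr0 -[RHS]addr0; congr (_ + _).
  by rewrite (@eq_count _ _ pred0) ?count_pred0.
(* The multiples of 1 + 2i are counted once in a^6 and once in q b^6, hence vanish mod 2. *)
by rewrite -addrA -natrD addnn -mul2n natrM pchar_Fp_0 // mul0r addr0.
Qed.

Lemma coef_theta_neq0 (F : fieldType) n e E :
  (theta n e : {poly F})`_E != 0 -> exists x, e x = E.
Proof.
rewrite /theta coef_sum => nz.
have [/existsP[k /eqP <-]|/existsPn nE] :=
  boolP [exists k : 'I_(n + n).+1, e (k%:Z - n%:Z) == E]; first by eexists.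
by case/eqP: nz; apply: big1 => k _; rewrite coefXn eq_sym (negbTE (nE k)).
Qed.

Lemma coef_sqrF2 (p : {poly 'F_2}) i :
  (p ^+ 2)`_i = if (2 %| i)%N then p`_(i %/ 2) else 0.
Proof.
rewrite -coef_comp_poly_Xn //; suff -> : p \Po 'X^2 = p ^+ 2 by [].
elim/poly_ind: p => [|p c IHp]; first by rewrite comp_poly0 expr0n.
rewrite comp_polyD comp_polyM comp_polyX comp_polyC IHp.
have cE : c%:P = c%:P ^+ 2 :> {poly 'F_2}.
  by rewrite -polyC_exp; congr polyC; apply/val_inj; case: c => -[|[|]].
by rewrite [in LHS]cE; ring: polyF2_2.
Qed.

(** * The eta quotient modulo 2 and its coefficients *)

Definition eta_prodF2 N : {poly 'F_2} := map_poly intr (eta_prod_trunc N).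

Lemma eta_prodF2E N : eqmX N.+1
  (eta_prodF2 N * (euler2 1 N * euler2 10 N ^+ 5)) (euler2 2 N * euler2 5 N ^+ 5).
Proof.
rewrite /eta_prodF2 /eta_prod_trunc rmorph_prod big_add1 /= big_mkord.
rewrite !euler2E -!prodrXl -!big_split /=.
apply: eqmX_prod => i.
have geomE d : (0 < d)%N ->
    eqmX N.+1 (map_poly intr (geom d N) * (1 + 'X^d)) (1 : {poly 'F_2}).
  move=> d0; rewrite /geom rmorph_sum /=.
  under eq_bigr => a _ do rewrite map_polyXn exprM.
  rewrite -[X in 1 + X]polyF2_opp -opprB mulrN mulrC -subrX1.
  rewrite /eqmX opprB addrC addKr dvdpNr -exprM.
  by apply: dvdp_exp2l; apply: leq_pmull.
rewrite !(rmorphM, rmorphXn, rmorphB, rmorph1) /= !map_polyX !polyF2_opp mul1n.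
set c := (1 + 'X^(2 * _)) * _ ^+ 5; set g := map_poly _ _; set h := map_poly _ _.
rewrite [X in eqmX _ X _](_ : _ =
    c * (g * (1 + 'X^(i.+1)) * (h * (1 + 'X^(10 * i.+1))) ^+ 5)); last first.
  by rewrite /c; ring.
have := eqmXM (eqmX_refl N.+1 c)
  (eqmXM (geomE i.+1 isT) (eqmX_exp 5 (geomE (10 * i.+1)%N isT))).
by rewrite expr1n !mulr1.
Qed.

(** Doubling is squaring, so the previous relation reads P a b^10 = a^2 b^5; cancel a b^5. *)
Lemma eta_prodF2_quotient N :
  eqmX N.+1 (eta_prodF2 N * euler2 5 N ^+ 5) (euler2 1 N).
Proof.
have := eta_prodF2E N.
rewrite (euler2_double 5) (euler2_double 1).
set A := euler2 1 N; set B := euler2 5 N => PE.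
have A0 : A.[0] = 1 by exact: euler2_at0.
have B0 : (B ^+ 5).[0] = 1 by rewrite horner_exp euler2_at0 // expr1n.
apply: (eqmX_cancel A0); apply: (eqmX_cancel B0).
rewrite (_ : B ^+ 5 * (A * (eta_prodF2 N * B ^+ 5)) =
  eta_prodF2 N * (A * (B ^+ 2) ^+ 5)); last by ring.
by rewrite (_ : B ^+ 5 * (A * A) = A ^+ 2 * B ^+ 5); last by ring.
Qed.

Lemma eta_coef_mod2 l : (eta_coef (4 * l + 2))%:~R =
  (euler2 1 (4 * l + 2) * euler2 5 (4 * l + 2))`_l :> 'F_2.
Proof.
set N := (4 * l + 2)%N; pose P := eta_prodF2 N.
have -> : (eta_coef N)%:~R = P`_N by rewrite /eta_coef /P coef_map.
have := eta_prodF2_quotient N; have := euler2_level5 N; rewrite -/P.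
set A := euler2 1 N; set B := euler2 5 N => AB PB.
have B0 : B.[0] = 1 by exact: euler2_at0.
have Bk0 k : (B ^+ k).[0] = 1 by rewrite horner_exp B0 expr1n.
(* [U] is the truncation of u = a / b: [B] has constant term 1, hence is invertible modulo
   X^(N+1). *)
have [U UB] : exists U, eqmX N.+1 (U * B) A.
  have /Bezout_eq1_coprimepP[[u v] /= uv1] : coprimep B 'X^(N.+1).
    by rewrite coprimep_expr // coprimepX rootE B0 oner_eq0.
  exists (A * u); rewrite /eqmX -mulrA -{2}[A]mulr1 -mulrBr -uv1.
  by rewrite opprD addNKr dvdp_mull // dvdpNr dvdp_mull.
have PE : eqmX N.+1 P ('X + U ^+ 6).
  apply: (eqmX_cancel (Bk0 6)).
  apply: eqmX_trans (_ : eqmX _ (A * B) _).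
    rewrite (_ : B ^+ 6 * P = P * B ^+ 5 * B); last by ring.
    exact: eqmXM PB (eqmX_refl _ _).
  apply: eqmX_trans AB _.
  rewrite (_ : B ^+ 6 * _ = (U * B) ^+ 6 + 'X * B ^+ 6); last by ring.
  by apply: eqmXD (eqmX_refl _ _); apply/eqmX_sym/eqmX_exp.
(* After multiplication by [B ^+ 4] the left side is A^3 B = A^2 (A B), and the formula for A B
   applies. *)
have UE : eqmX N.+1 (U ^+ 3) ((U ^+ 4 * B ^+ 2) ^+ 2 + 'X * (A * B) ^+ 2).
  apply: (eqmX_cancel (Bk0 4)).
  rewrite (_ : _ * U ^+ 3 = (U * B) ^+ 3 * B); last by ring.
  rewrite (_ : _ * (_ + _) = (U * B) ^+ 8 + 'X * A ^+ 2 * B ^+ 6); last by ring.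
  apply: eqmX_trans (eqmXM (eqmX_exp 3 UB) (eqmX_refl _ B)) _.
  rewrite (_ : A ^+ 3 * B = A ^+ 2 * (A * B)); last by ring.
  apply: eqmX_trans (eqmXM (eqmX_refl _ _) AB) _.
  rewrite (_ : _ * (_ + _) = A ^+ 8 + 'X * A ^+ 2 * B ^+ 6); last by ring.
  by apply: eqmXD (eqmX_refl _ _); apply/eqmX_sym/eqmX_exp.
(* Index 4l + 2 of (U^3)^2 is index 2l + 1 of U^3. An odd index sees only X (A B)^2, whose
   coefficient there is that of X^l in A B. *)
rewrite (eqmX_coef PE) // (exprM U 3 2) coefD coefX coef_sqrF2.
rewrite (_ : (2 %| N)%N); last by rewrite /N; lia.
rewrite (_ : (N == 1)%N = false) ?add0r; last by rewrite /N; lia.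
rewrite (_ : N %/ 2 = (2 * l).+1)%N; last by rewrite /N; lia.
rewrite (eqmX_coef UE); last by rewrite /N; lia.
rewrite coefD coefXM /= !coef_sqrF2.
rewrite (_ : (2 %| (2 * l).+1)%N = false) ?add0r; last by lia.
by rewrite dvdn_mulr // mulKn.
Qed.

Lemma odd_eta_coef l : ~~ (2 %| eta_coef (4 * l + 2))%Z ->
  exists x : int, 4 * l%:Z + 1 = (4 * x + 1) ^+ 2 \/
                  4 * l%:Z + 1 = 5 * (4 * x + 1) ^+ 2.
Proof.
rewrite (dvdz_pcharf (pchar_Fp (isT : prime 2))) eta_coef_mod2.
move: (4 * l + 2)%N (leq_addr 2 (4 * l)) => N leN.
have lN : (l < N.+1)%N by lia.
rewrite (eqmX_coef (euler2_level5 N) lN) coefD coefXM.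
rewrite (eqmX_coef (euler2_sixth N (isT : 0 < 1)%N) lN).
have [->|nz _] := eqVneq (theta N (texp (6 * 1) (2 * 1)) : {poly 'F_2})`_l 0.
  case: l {leN} lN => [|l] lN; rewrite /= add0r ?eqxx //.
  rewrite (eqmX_coef (euler2_sixth N (isT : 0 < 5)%N) (ltnW lN)).
  case/coef_theta_neq0 => x Ex; exists x; right.
  (* Here l = 1 + 20x^2 + 10x, the 1 coming from the factor X. *)
  by have := texpE (6 * 5) (2 * 5) x; rewrite !expr2 Ex; lia.
have [x Ex] := coef_theta_neq0 nz; exists x; left.
by have := texpE (6 * 1) (2 * 1) x; rewrite !expr2 Ex; lia.
Qed.

(** * The congruence, by parity of a prime valuation *)

Lemma odd_J10 z : (z %% 4)%Z = 1 -> ~~ (2 %| J10 z)%Z ->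
  exists x : int, z = (4 * x + 1) ^+ 2 \/ z = 5 * (4 * x + 1) ^+ 2.
Proof.
case: z => [m | [|m]] zmod; [|by lia|by rewrite dvdz0].
have [l ->] : exists l, m = (4 * l + 1)%N by exists (m %/ 4)%N; lia.
rewrite /J10 addn1 /= subr0 -addn2 => /odd_eta_coef[x xE]; exists x.
by rewrite -addn1 PoszD PoszM.
Qed.

Theorem theorem4p2 (k n : nat) (p : nat -> nat)
  (hp : forall i : nat, (1 <= i <= k.+1)%N -> prime (p i) /\ (p i %% 4 = 3)%N)
  (j : int) (hj : ~~ ((p k.+1)%:Z %| j)%Z) :
  (2 %| J10 ((\prod_(1 <= i < k.+1) (p i ^ 2)%N)%:Z * (p k.+1)%:Z *
             (4 * (p k.+1)%:Z * n%:Z + 4 * j + (p k.+1)%:Z)))%Z.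
Proof.
have [R oddR ->] : exists2 R, odd R & (\prod_(1 <= i < k.+1) (p i ^ 2) = R ^ 2)%N.
  rewrite big_seq; elim/big_rec: _ => [|i _ /[!mem_index_iota] ik [R oddR ->]].
    by exists 1%N.
  have [_ pi3] := hp i ltac:(lia).
  by exists (p i * R)%N; rewrite ?expnMn // oddM oddR andbT; lia.
have [] := hp k.+1 ltac:(lia); move: (p k.+1) hj => q hj q_pr q3.
set w := 4 * _ * _ + _ + _.
(* [w] is 4j modulo [q], and [q] is odd. *)
have qNw : ~~ (q %| `|w|)%N.
  rewrite -[(q %| _)%N]/(q%:Z %| w)%Z.
  rewrite /w rpredDr ?dvdzz // rpredDl; last by rewrite mulrAC dvdz_mull.
  rewrite Gauss_dvdzr // coprimezE coprime_sym (@coprimeXl 2 2) // coprime2n.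
  by lia.
have w0 : (0 < `|w|)%N by rewrite lt0n; apply: contraNneq qNw => ->; rewrite dvdn0.
have R0 : (0 < R)%N by case: (R) oddR.
have odd_log : odd (logn q (absz ((R ^ 2)%N%:Z * q%:Z * w))).
  rewrite !abszM !absz_nat !lognM ?muln_gt0 ?expn_gt0 ?R0 ?w0 ?(prime_gt0 q_pr) //.
  rewrite addnn (logn_prime q q_pr) eqxx (lognE q `|w|) (negbTE qNw) !andbF.
  by rewrite addn0 addn1 /= odd_double.
apply: contraT => J10_odd; have [|x [] E] := odd_J10 _ J10_odd.
(* The argument is 1 * 3 * 3 = 1 modulo 4, as [odd_J10] requires. *)
- have [r rE] : exists r : int, (R ^ 2)%N%:Z = 4 * r + 1.
    exists ((R./2)%:Z * ((R./2)%:Z + 1)).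
    by rewrite -[in LHS](odd_double_half R) oddR PoszM; lia.
  have [s sE] : exists s : int, q%:Z = 4 * s + 3 by exists (q %/ 4)%N; lia.
  have [v vE] : exists v : int, w = 4 * v + 3.
    by exists (q%:Z * n%:Z + j + s); rewrite /w sE; ring.
  rewrite rE sE vE (_ : _ * _ * _ = (r * ((4 * s + 3) * (4 * v + 3)) +
    4 * s * v + 3 * s + 3 * v + 2) * 4 + 1); last by ring.
  by rewrite modzMDl.
- by move: odd_log; rewrite E abszX lognX mul2n odd_double.
(* The factor 5 leaves the valuation even, since [q] is 3 modulo 4 and so differs from 5. *)
move: odd_log; rewrite E abszM abszX lognM //; last by rewrite expn_gt0; lia.
rewrite lognX mul2n oddD odd_double addbF logn_prime //.
by case: eqP => // ?; lia.
Qed.
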